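(* There exist positive absolute constants $c_{1},c_{2}$ such that, for every positive integer $s$, $$c_{1}s^{2}\le f_{2}(2,s,s)\le c_{2}s^{2}.$$
   Context: A set in $\mathbb{R}^{d}$ is called $s$-convex if it is a union of at most $s$ convex sets. For integers $r\ge 2$, $d\ge 1$ and $s_{1},\ldots,s_{r}\ge 1$, let $f_{r}(d,s_{1},\ldots,s_{r})$ be the least integer $N$ with the following property: whenever $P\subseteq\mathbb{R}^{d}$ is finite and $|P|\ge N$, there is a partition $P=P_{1}\sqcup\cdots\sqcup P_{r}$ into nonempty parts such that every choice of $s_{i}$-convex sets $C_{i}\supseteq P_{i}$, $i\in[r]=\{1,\ldots,r\}$, satisfies $\bigcap_{i=1}^{r}C_{i}\ne\emptyset$. Here the function is used with $r=2$, $d=2$, $s_{1}=s_{2}=s$. *)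

(* Defs.v *)
From HB Require Import structures.
From mathcomp Require Import all_boot all_order all_algebra finmap.
From mathcomp Require Import boolp classical_sets reals convex.

Set Implicit Arguments.
Unset Strict Implicit.
Unset Printing Implicit Defensive.

Import Order.TTheory GRing.Theory Num.Theory.

Local Open Scope classical_set_scope.
Local Open Scope ring_scope.

Definition s_convex (R : realType) (d s : nat) (C : set 'rV[R]_d) : Prop :=
  exists (k : nat) (D : 'I_k -> set 'rV[R]_d),
    [/\ (k <= s)%N,
        forall j, @convex_set R 'rV[R]_d (D j)
      & C = \bigcup_(j in setT) D j].

Definition s_tverberg_partition (R : realType) (r d : nat) (s : 'I_r -> nat)
    (P : {fset 'rV[R]_d}) (Q : 'I_r -> set 'rV[R]_d) : Prop :=
  classical_sets.partition setT Q [set` P] /\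
  forall C : 'I_r -> set 'rV[R]_d,
    (forall i, s_convex (s i) (C i)) -> (forall i, Q i `<=` C i) ->
    \bigcap_(i in setT) C i !=set0.

Definition s_tverberg_bound (R : realType) (r d : nat) (s : 'I_r -> nat)
    (N : nat) : Prop :=
  forall P : {fset 'rV[R]_d}, (N <= #|` P|)%N ->
    exists Q : 'I_r -> set 'rV[R]_d, s_tverberg_partition s P Q.

(* [is_s_tverberg_number R d s N] reads "f_r(d, s_1, ..., s_r) exists and
   equals N".  For r > 0 the bound property fails at N = 0 (take P empty), so
   the least such integer and the least such natural number agree. *)
Definition is_s_tverberg_number (R : realType) (r d : nat) (s : 'I_r -> nat)
    (N : nat) : Prop :=
  s_tverberg_bound R d s N /\
  forall M : nat, s_tverberg_bound R d s M -> (N <= M)%N.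

Lemma is_s_tverberg_number_unique (R : realType) (r d : nat) (s : 'I_r -> nat)
    (N N' : nat) :
  is_s_tverberg_number R d s N -> is_s_tverberg_number R d s N' -> N = N'.
Proof.
move=> [bN minN] [bN' minN']; apply/eqP.
by rewrite eqn_leq minN// minN'.
Qed.

(* Main.v *)
Require Import Defs.
From mathcomp Require Import boolp.
From mathcomp Require Import all_boot all_order all_algebra.
From mathcomp Require Import reals.
From mathcomp Require Import zify ring lra.

Set Implicit Arguments.
Unset Strict Implicit.
Unset Printing Implicit Defensive.

Import Order.TTheory GRing.Theory Num.Theory.

Local Open Scope ring_scope.

(** Call a 2-colouring of a finite planar set separable when its two classes
    are covered by s convex sets each, no set of the first family meeting a
    set of the second.  A set of points is bad for the Tverberg property
    exactly when all its 2-colourings with two nonempty classes are separable.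

    Lower bound: some s ^ 2 points have only separable colourings.  Place s
    arcs of s points each along a parabola, every arc bulging towards the inside
    of the parabola.  The i-th points of all arcs form a
    first family of s groups, the arcs form a second one.  The tangent at the
    i-th point of the j-th arc has the rest of that arc strictly on one side
    and the i-th points of all other arcs strictly on the other side
    ([arc_tangent_same_arc], [arc_tangent_other_arc]); so whatever the
    colouring, the points of the first colour in group i can be separated from
    the points of the second colour in arc j.

    Upper bound: the separable colourings of n = 672 s ^ 2 points number less
    than 2 ^ n - 2.  Recording the s ^ 2 lines that separate the clusters of
    the two colours would cost n ^ O(s ^ 2), a logarithm too much in the
    exponent.  A colouring is encoded more cheaply as follows, the first
    coordinate x being made injective by a shear.

    Record for each of the 2s clusters the segment joining its leftmost and
    rightmost points, its chord; this costs only n ^ (4 s).  Chords of opposite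
    colours never cross, so between two consecutive ends of chords they are
    stacked in a fixed order up to crossings of chords of the same colour.
    Classify the points by the slab that contains them and by the number of
    chords below them.  There are O(s ^ 2) such cells, and inside a cell the
    clusters of one colour all lie above the clusters of the other
    ([cell_orientation]).

    The curve between the two colours inside a cell may bend.  A bend shows up
    as a crossed triple p, q, r, from left to right, with p and r of one
    colour and q of the other, on the wrong side of the segment pr.  All
    clusters on the same side of the cluster of q are separated from it by
    one line each, and the slope of the envelope of these at most s lines
    strictly changes across every crossed triple ([interlaced_card]).  Hence at
    most s crossed triples with non-overlapping x-ranges share the cluster
    and the side of q, and cutting the cells at the right ends of a greedy
    choice of crossed triples ([greedy_piercing]) leaves O(s ^ 2) blocks
    without crossed triples ([crossed_selection]).  In such a block the
    colouring is an honest separation by a line, determined by two extremal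
    points ([reads_uncrossed]).

    So a colouring is decoded from the chords and from four subsets of size at
    most 19 s ^ 2: the heads of the blocks, the heads of the cells with the
    first colour on top, and the two kinds of extremal points
    ([colouring_decoded]).  Subsets need no labels, whence the gain: there are
    at most 2 ^ (127 s ^ 2) of them, and the codes number at most
    2 ^ (556 s ^ 2). *)

(** * Separation of finite families by a line *)

Section FiniteSeparation.
Variable R : realFieldType.

Lemma strict_between (I J : finType) (A : {pred I}) (B : {pred J})
    (f : I -> R) (g : J -> R) :
  (forall i j, i \in A -> j \in B -> g j < f i) ->
  exists m, (forall j, j \in B -> g j < m) /\ (forall i, i \in A -> m < f i).
Proof.
move=> gf.
have [i0 A0|A0] := pickP A; last first.
  exists (1 + \sum_j `|g j|); split=> [j _|i]; last first.
    by rewrite unfold_in A0.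
  rewrite (bigD1 j) //= addrA.
  have : 0 <= \sum_(i | i != j) `|g i| by apply: sumr_ge0.
  have := ler_norm (g j); lra.
have [j0 B0|B0] := pickP B; last first.
  exists (- (1 + \sum_i `|f i|)); split=> [j|i _].
    by rewrite unfold_in B0.
  rewrite (bigD1 i) //= addrA.
  have : 0 <= \sum_(j | j != i) `|f j| by apply: sumr_ge0.
  have := ler_norm (- f i); rewrite normrN; lra.
case: (Order.TotalTheory.arg_minP f A0) => i Ai fi.
case: (Order.TotalTheory.arg_maxP g B0) => j Bj gj.
have := gf _ _ Ai Bj => lt_ij.
have {}fi i' : i' \in A -> f i <= f i' by apply: fi.
have {}gj j' : j' \in B -> g j' <= g j by apply: gj.
exists ((g j + f i) / 2); split=> [j' /gj|i' /fi] ?; lra.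
Qed.

(** Planar sets are binary predicates on the coordinates, because the sheared
    coordinates of a point are what the argument uses. *)
Definition convex2 (A : R -> R -> Prop) := forall x y x' y' t,
  A x y -> A x' y' -> 0 <= t <= 1 ->
  A ((1 - t) * x + t * x') ((1 - t) * y + t * y').

Definition over (A B : R -> R -> Prop) := forall x y y',
  A x y -> B x y' -> y' < y.

(** If the vertical order of two disjoint convex sets were different over
    two abscissas, interpolating between them would produce a common point. *)
Lemma over_of_pair (A B : R -> R -> Prop) x y y' :
  convex2 A -> convex2 B -> (forall x y, A x y -> B x y -> False) ->
  A x y -> B x y' -> y' < y -> over A B.
Proof.
move=> cA cB dAB Axy Bxy' lt_y x1 y1 y1' A1 B1; case: ltgtP => // [lt1|e1].
  (* the parameter at which the interpolated heights agree *)
  pose t := (y - y') / ((y - y') + (y1' - y1)).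
  have t01 : 0 <= t <= 1.
    by rewrite divr_ge0 ?ler_pdivrMr /=; lra.
  have := dAB _ _ (cA _ _ _ _ _ Axy A1 t01).
  suff -> : (1 - t) * y + t * y1 = (1 - t) * y' + t * y1'.
    by move=> /(_ (cB _ _ _ _ _ Bxy' B1 t01)).
  rewrite /t; field; lra.
by case: (dAB x1 y1); rewrite // -?e1.
Qed.

(** A slope a works when it is larger than the slopes from p to q for all
    pairs with p on the left and smaller than those with p on the right.  The
    two kinds of constraints are compatible: for a pair p, q of one kind and a
    pair p', q' of the other, the points dividing pp' and qq' in a suitable
    ratio have the same abscissa, and A is over B there. *)
Lemma over_separating_line (T : finType) (x y : T -> R) (P Q : {pred T})
    (A B : R -> R -> Prop) :
  {in P & Q, forall p q, x p != x q} ->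
  {in P, forall p, A (x p) (y p)} -> {in Q, forall q, B (x q) (y q)} ->
  convex2 A -> convex2 B -> over A B ->
  exists a b, {in P, forall p, a * x p + b < y p} /\
              {in Q, forall q, y q < a * x q + b}.
Proof.
move=> neq PA QB cA cB AB.
pose slope (u : T * T) := (y u.1 - y u.2) / (x u.1 - x u.2).
pose lo := [pred u : T * T | [&& u.1 \in P, u.2 \in Q & x u.1 < x u.2]].
pose hi := [pred u : T * T | [&& u.1 \in P, u.2 \in Q & x u.2 < x u.1]].
have [[p q] [p' q']|a [lo_a hi_a]] := @strict_between _ _ hi lo slope slope.
  rewrite !inE /slope /= => /and3P[pP qQ lt1] /and3P[pP' qQ' lt2].
  set d1 := x q' - x p'; set d2 := x p - x q.
  have [d10 d20] : 0 < d1 /\ 0 < d2 by rewrite /d1 /d2; lra.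
  (* the ratio giving equal abscissas *)
  pose t := d1 / (d1 + d2).
  have t01 : 0 <= t <= 1 by rewrite divr_ge0 ?ler_pdivrMr /=; lra.
  have H1 := cA _ _ _ _ _ (PA _ pP') (PA _ pP) t01.
  have H2 := cB _ _ _ _ _ (QB _ qQ') (QB _ qQ) t01.
  have exx : (1 - t) * x p' + t * x p = (1 - t) * x q' + t * x q.
    rewrite /t; suff : (d1 + d2) * ((1 - d1 / (d1 + d2)) * x p' + d1 / (d1 + d2) * x p) =
       (d1 + d2) * ((1 - d1 / (d1 + d2)) * x q' + d1 / (d1 + d2) * x q).
      by apply: mulfI; lra.
    have -> : x p' = x q' - d1 by rewrite /d1; ring.
    have -> : x p = x q + d2 by rewrite /d2; ring.
    field; lra.
  rewrite exx in H1; have := AB _ _ _ H1 H2.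
  rewrite -subr_gt0.
  have -> : (1 - t) * y p' + t * y p - ((1 - t) * y q' + t * y q) =
      (d2 * (y p' - y q') + d1 * (y p - y q)) / (d1 + d2).
    by rewrite /t; field; lra.
  rewrite pmulr_lgt0 ?invr_gt0; last lra.
  move=> gt0.
  have -> : (y p' - y q') / (x p' - x q') = - ((y p' - y q') / d1).
    rewrite -mulrN -invrN; congr (_ / _); rewrite /d1; lra.
  rewrite -subr_gt0 opprK.
  have -> : (y p - y q) / (x p - x q) + (y p' - y q') / d1 =
      (d2 * (y p' - y q') + d1 * (y p - y q)) / (d1 * d2).
    by rewrite -/d2; field; lra.
  by rewrite divr_gt0 ?mulr_gt0.
have [p q pP qQ|b [bQ bP]] :=
    @strict_between _ _ P Q (fun p => y p - a * x p) (fun q => y q - a * x q).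
  case: (ltgtP (x p) (x q)) (neq _ _ pP qQ) => // lt_pq _.
    have := lo_a (p, q); rewrite !inE /= pP qQ lt_pq /slope /= => /(_ isT).
    rewrite ltr_ndivrMr; lra.
  have := hi_a (p, q); rewrite !inE /= pP qQ lt_pq /slope /= => /(_ isT).
  rewrite ltr_pdivlMr; lra.
by exists a, b; split=> [p /bP|q /bQ]; lra.
Qed.

End FiniteSeparation.

(** * Crossed triples *)

Section Triples.
Variables (R : realFieldType) (T : finType) (x y : T -> R).

(** A positive multiple of the height of q over the line pr when
    x p < x q < x r. *)
Definition height (p q r : T) : R :=
  (y q - y p) * (x r - x p) - (y r - y p) * (x q - x p).

(** A lower envelope of lines has nonincreasing slopes.  If the slope were the
    same at both ends of a triple, one line of the envelope would run below
    p and r and above q, against the position of q on or above pr.  So the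
    slope drops strictly across each triple, and the index of the line of the
    envelope at the right end tells the triples apart. *)
Lemma interlaced_card (I : finType) (D : {pred I}) (a b : I -> R) (f : T -> I)
    (S : {set T * T * T}) :
  (forall p q r, (p, q, r) \in S ->
     [/\ x p < x q < x r, 0 <= height p q r, f p \in D & f r \in D]) ->
  (forall p q r, (p, q, r) \in S ->
     [/\ a (f p) * x p + b (f p) < y p, a (f r) * x r + b (f r) < y r &
         {in D, forall i, y q < a i * x q + b i}]) ->
  (forall t t', t \in S -> t' \in S -> t != t' ->
     (x t.2 <= x t'.1.1) || (x t'.2 <= x t.1.1)) ->
  (#|S| <= #|I|)%N.
Proof.
move=> SD Sab Sdisj.
have [->|[[[p0 q0] r0] S0]] := set_0Vmem S; first by rewrite cards0.
have [_ _ D0 _] := SD _ _ _ S0.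
(* g z is the index of a line of the lower envelope at z *)
have /= [g gP] : exists g : R -> I, forall z, g z \in D /\
    forall i, i \in D -> a (g z) * z + b (g z) <= a i * z + b i.
  exists (fun z => [arg min_(i < f p0 in D) (a i * z + b i)]%O) => z.
  by case: Order.TotalTheory.arg_minP => // i Di le_i; split.
have g_mono z z' : z <= z' -> a (g z') <= a (g z).
  rewrite le_eqVlt => /orP[/eqP -> //|lt_z].
  have [Dz le_z] := gP z; have [Dz' le_z'] := gP z'.
  have := le_z _ Dz'; have := le_z' _ Dz => H1 H2.
  rewrite -subr_ge0 -(pmulr_lge0 _ (_ : 0 < z' - z)) ?subr_gt0 //; lra.
have g_drop p q r : (p, q, r) \in S -> a (g (x r)) < a (g (x p)).
  move=> tS; have [/andP[pq qr] hq Dp Dr] := SD _ _ _ tS.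
  have [lp lr lq] := Sab _ _ _ tS.
  have [D1 le1] := gP (x p); have [D2 le2] := gP (x r).
  rewrite lt_neqAle g_mono ?andbT; last lra.
  apply/eqP => ea.
  have := le1 _ D2; have := le2 _ D1; rewrite ea => eb1 eb2.
  have := lq _ D1; have := le1 _ Dp; have := le2 _ Dr; rewrite ea.
  set A := a _; set B1 := b _; set B2 := b (g _).
  have -> : B2 = B1 by rewrite /B1 /B2; lra.
  move=> h1 h2 h3; move: hq; rewrite /height.
  have k1 : 0 < (y r - (A * x r + B1)) * (x q - x p) by apply: mulr_gt0; lra.
  have k2 : 0 < (y p - (A * x p + B1)) * (x r - x q) by apply: mulr_gt0; lra.
  have k3 : 0 < (A * x q + B1 - y q) * (x r - x p) by apply: mulr_gt0; lra.
  lra.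
have inj_g : {in S &, injective (fun t => g (x t.2))}.
  move=> [[p q] r] [[p' q'] r'] tS tS' /= eg; apply/eqP/negPn/negP => neq.
  case/orP: (Sdisj _ _ tS tS' neq) => /= /g_mono.
    by have := g_drop _ _ _ tS'; rewrite eg; lra.
  by have := g_drop _ _ _ tS; rewrite eg; lra.
by rewrite -(card_in_imset inj_g) max_card.
Qed.

Definition crossed (up : pred T) (p q r : T) :=
  [&& x p < x q, x q < x r, up p == up r, up q != up p &
      if up q then height p q r <= 0 else 0 <= height p q r].

(** The rule for the side of p with respect to the line uv, where x v < x u:
    on the line itself, the upper points start at u. *)
Definition above (u v p : T) :=
  let e := (y p - y v) * (x u - x v) - (y u - y v) * (x p - x v) in
  (0 < e) || (e == 0) && (x u <= x p).

(** Without u, the upper points are those to the left of v, and all points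
    when v is missing too. *)
Definition reads (o : option T * option T) (p : T) :=
  match o with
  | (Some u, Some v) => above u v p
  | (None, Some v) => ~~ (x v <= x p)
  | _ => true
  end.

(** When some upper point lies to the right of a lower one, let (u, v) have
    the least slope among such pairs, and the least width among those of
    least slope.  A point misplaced with respect to the line uv would give a
    smaller slope or width, or form a crossed triple with u and v.  In the
    remaining case all upper points precede all lower ones, and the leftmost
    lower point v is enough. *)
Lemma reads_uncrossed (B : {set T}) (up : pred T) :
  injective x ->
  {in B & &, forall p q r, ~~ crossed up p q r} ->
  exists o : option T * option T,
    [/\ forall u, o.1 = Some u -> u \in B, forall v, o.2 = Some v -> v \in B &
        {in B, forall p, up p = reads o p}].
Proof.
move=> injx noX.
pose Q := [pred w : T * T | [&& w.1 \in B, up w.1, w.2 \in B, ~~ up w.2 &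
                                x w.2 < x w.1]].
pose slope (w : T * T) := (y w.1 - y w.2) / (x w.1 - x w.2).
have slopeE w : x w.1 != x w.2 -> y w.1 - y w.2 = slope w * (x w.1 - x w.2).
  by move=> neq; rewrite /slope mulfVK // subr_eq0.
have [w0 Qw0|Q0] := pickP Q.
  case: (Order.TotalTheory.arg_minP slope Qw0) => w1 Qw1 min1.
  pose Q' := [pred w | Q w && (slope w == slope w1)].
  have Q'w1 : Q' w1 by apply/andP.
  case: (Order.TotalTheory.arg_minP (fun w => x w.1 - x w.2) Q'w1) => [[u v]].
  move=> /andP[Quv /eqP suv] min2.
  have {}min1 w : Q w -> slope (u, v) <= slope w by rewrite suv; apply: min1.
  have {}min2 w : Q w -> slope w = slope (u, v) -> x u - x v <= x w.1 - x w.2.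
    by move=> Qw sw; apply: min2; apply/andP; rewrite sw suv.
  move: (Quv); rewrite inE /= => /and5P[uB uu vB vv lt_vu].
  have /= := slopeE (u, v); rewrite gt_eqF // => /(_ isT) yuv.
  exists (Some u, Some v); split=> [_ [<-]|_ [<-]|p pB] //=.
  rewrite /above; case: (boolP (up p)) => upp.
    case: (ltgtP (x p) (x v)) => [lt_pv|lt_vp|/injx epv].
    - have := noX _ _ _ pB vB uB; rewrite /crossed lt_pv lt_vu upp uu (negPf vv) /=.
      rewrite -ltNge /height => h.
      by symmetry; apply/orP; left; nra.
    - have Qpv : Q (p, v) by rewrite inE /= pB upp vB vv.
      have := min1 _ Qpv; have := min2 _ Qpv => /= h2 h1.
      have /= := slopeE (p, v); rewrite gt_eqF // => /(_ isT) ypv.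
      move: h1; rewrite le_eqVlt => /orP[/eqP e1|lt1]; symmetry.
        apply/orP; right; rewrite ypv yuv e1 mulrAC subrr eqxx /=.
        by have := h2 (esym e1); lra.
      apply/orP; left; rewrite ypv yuv.
      rewrite [X in _ < X](_ : _ = (slope (p, v) - slope (u, v)) *
         ((x p - x v) * (x u - x v))); last by ring.
      by rewrite !mulr_gt0 // subr_gt0.
    - by rewrite -epv upp in vv.
  symmetry; apply/negbTE; rewrite negb_or -leNgt negb_and -ltNge.
  case: (ltgtP (x p) (x u)) => [lt_pu|lt_up|/injx epu].
  - have Qup : Q (u, p) by rewrite inE /= pB upp uB uu.
    have := min1 _ Qup; have := min2 _ Qup => /= h2 h1.
    have /= := slopeE (u, p); rewrite gt_eqF // => /(_ isT) yup.
    rewrite orbT andbT.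
    have -> : y p - y v = slope (u, v) * (x u - x v) -
       slope (u, p) * (x u - x p) by rewrite -yuv -yup; ring.
    rewrite yuv -subr_ge0 sub0r.
    rewrite [X in _ <= X](_ : _ = (slope (u, p) - slope (u, v)) *
         ((x u - x p) * (x u - x v))); last by ring.
    by rewrite !mulr_ge0 // subr_ge0 // ltW.
  - have := noX _ _ _ vB uB pB; rewrite /crossed lt_up lt_vu (negPf upp) uu (negPf vv) /=.
    rewrite -ltNge /height orbF => h.
    have lt0 : (y p - y v) * (x u - x v) - (y u - y v) * (x p - x v) < 0 by lra.
    by rewrite ltW ?lt_eqF.
  - by rewrite -epu (negPf upp) in uu.
have sep p q : p \in B -> q \in B -> up p -> ~~ up q -> x p < x q.
  move=> pB qB upp upq; have := Q0 (p, q); rewrite inE /= pB qB upp upq /=.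
  case: ltgtP => // /injx epq; by rewrite epq upp in upq.
have [v0 v0P|noV] := pickP [pred v | (v \in B) && ~~ up v]; last first.
  exists (None, None); split=> // p pB /=; apply/negbNE.
  by have := noV p; rewrite inE pB /= => ->.
case: (Order.TotalTheory.arg_minP x v0P) => v /andP[vB vv] minv.
exists (None, Some v); split=> // [_ [<-]//|p pB /=].
case: (boolP (up p)) => upp; symmetry.
  by rewrite -ltNge; apply: sep.
by apply/negbF; apply: minv; rewrite inE pB.
Qed.

End Triples.

(** * Piercing intervals, and counting small sets *)

Section Counting.

(** Greedy choice: take the interval with the least right end, discard the
    intervals of its cell that contain this end other than as their left end,
    and go on with the others. *)
Lemma greedy_piercing (R : realFieldType) (J : finType) (K : eqType)
    (cell : J -> K) (lo hi : J -> R) (F : {set J}) :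
  {in F, forall t, lo t < hi t} ->
  exists S : {set J}, [/\ S \subset F,
    {in F, forall t, exists2 t', t' \in S &
       [/\ cell t' = cell t, lo t < hi t' & hi t' <= hi t]} &
    {in S &, forall t t', t != t' -> cell t = cell t' ->
       (hi t <= lo t') || (hi t' <= lo t)}].
Proof.
have [n] := ubnP #|F|; elim: n F => // n IH F ltF lohi.
have [->|[t1 F1]] := set_0Vmem F.
  by exists set0; split=> // t; rewrite inE.
case: (Order.TotalTheory.arg_minP hi F1) => t0 F0 min0.
have {}F0 : t0 \in F by [].
pose F' := [set t in F | (cell t != cell t0) || (hi t0 <= lo t)].
have [|t|S [SF' hitS disS]] := IH F'; last 1 first.
- exists (t0 |: S); split.
  + rewrite subUset sub1set F0; apply: subset_trans SF' _.
    by apply/subsetP => t; rewrite inE => /andP[].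
  + move=> t Ft; case: (boolP (t \in F')) => [/hitS[t' St' ht']|].
      by exists t' => //; rewrite inE St' orbT.
    rewrite inE Ft /= negb_or negbK -ltNge => /andP[/eqP ct lt_t].
    by exists t0; rewrite ?setU11 //; split=> //; apply: min0.
  + have far t : t \in S -> cell t = cell t0 -> hi t0 <= lo t.
      by move=> /(subsetP SF'); rewrite inE => /andP[_ /orP[/eqP|]].
    move=> t t'; rewrite !inE => /orP[/eqP->|St] /orP[/eqP->|St'].
    * by rewrite eqxx.
    * by move=> _ ct; rewrite far.
    * by move=> _ ct; rewrite (far t) ?orbT.
    * exact: disS.
- suff : F' \proper F by move/proper_card; lia.
  apply/properP; split; first by apply/subsetP => t; rewrite inE => /andP[].
  by exists t0; rewrite // inE eqxx F0 /= -ltNge lohi.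
- by rewrite inE => /andP[/lohi].
Qed.

(** Give each set A the weight K to the size of its complement: the total
    weight is (K + 1) ^ #|T|, and a small set weighs at least K ^ (#|T| - M). *)
Lemma card_small_sets (T : finType) (M K : nat) : (0 < K)%N ->
  (#|[set A : {set T} | (#|A| <= M)%N]| * K ^ #|T| <= K ^ M * K.+1 ^ #|T|)%N.
Proof.
move=> K0.
have -> : (K.+1 ^ #|T| = \sum_(A : {set T}) K ^ #|~: A|)%N.
  transitivity (\prod_(i : T) (1 + K))%N; first by rewrite prod_nat_const.
  rewrite bigA_distr; apply: eq_big => // A _.
  rewrite -prod_nat_const [RHS]big_mkcond /=; apply: eq_bigr => i _.
  by rewrite inE; case: (i \in A).
rewrite -sum1_card big_distrl big_distrr /=.
rewrite [X in (_ <= X)%N](bigID (fun A : {set T} => #|A| <= M)%N) /=.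
rewrite (eq_bigl (fun A : {set T} => #|A| <= M)%N); last by move=> A; rewrite inE.
apply: leq_trans (leq_addr _ _); apply: leq_sum => A leA.
rewrite mul1n -expnD leq_pexp2l // -(cardsC A); lia.
Qed.

(** K = 31 makes K + 1 a power of 2, and (32 / 31) ^ 21 <= 2. *)
Lemma card_small_sets_pow2 (T : finType) (q m : nat) :
  #|T| = (21 * q)%N ->
  (#|[set A : {set T} | (#|A| <= m)%N]| <= 2 ^ (5 * m + q))%N.
Proof.
move=> cT; have := @card_small_sets T m 31 isT; rewrite cT.
have pow_le k : 32%:R ^+ k <= 2%:R * 31%:R ^+ k :> rat ->
    (32 ^ (k * q) <= 2 ^ q * 31 ^ (k * q))%N.
  rewrite -!natrX -natrM ler_nat !(expnM _ k) -expnMn => le_k.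
  by case: (posnP q) => [-> //|q0]; rewrite leq_exp2r.
have {pow_le}/pow_le : 32%:R ^+ 21 <= 2%:R * 31%:R ^+ 21 :> rat by lra.
move: (21 * q)%N => n h1.
have h2 : (31 ^ m <= 2 ^ (5 * m))%N.
  by case: (posnP m) => [-> //|m0]; rewrite expnM leq_exp2r.
move=> h; rewrite -(leq_pmul2r (_ : 0 < 31 ^ n)%N) ?expn_gt0 //.
apply: leq_trans h _; rewrite expnD -mulnA; exact: leq_mul.
Qed.

End Counting.

(** * Cells, blocks and the decoding of a colouring *)

Section Cells.
Variables (R : realFieldType) (T : finType) (x y : T -> R) (s : nat).
Hypothesis injx : injective x.

Notation cluster := (bool * 'I_s)%type.
Implicit Types (ch : {ffun cluster -> T * T}) (St Fi U V : {set T}).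

Definition active ch (c : cluster) (xi : R) :=
  x (ch c).1 <= xi <= x (ch c).2.

Definition chord ch (c : cluster) (xi : R) : R :=
  y (ch c).1 + (xi - x (ch c).1) *
    ((y (ch c).2 - y (ch c).1) / (x (ch c).2 - x (ch c).1)).

(** Both terms are nondecreasing in xi, so equal sums mean that no chord starts
    or ends in between. *)
Definition slab ch (xi : R) : nat :=
  (#|[set c | (x (ch c).1 <= xi)%R]| + #|[set c | (x (ch c).2 < xi)%R]|)%N.

Definition below ch (p : T) : {set cluster} :=
  [set c | active ch c (x p) && (chord ch c (x p) < y p)].

Definition cell ch (p : T) : nat * nat := (slab ch (x p), #|below ch p|).

(** St is meant to contain the leftmost point of each cell: the cells are cut
    just before each point of St. *)
Definition same_block ch St (p q : T) :=
  (cell ch p == cell ch q) &&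
  [forall z in St, (cell ch z == cell ch p) ==>
                     ((x z <= x p) == (x z <= x q))].

(** [reads] finds out whether p is on the upper side, and Fi marks the cells in
    which the colour [true] is on the upper side.  The sets U and V carry the
    points u and v of all blocks at once: the block of p selects its own. *)
Definition decode ch St Fi U V (p : T) : bool :=
  reads x y ([pick u in U | same_block ch St p u],
             [pick v in V | same_block ch St p v]) p
  == [exists z in Fi, cell ch z == cell ch p].

Lemma slab_sets ch xi xi' : xi <= xi' ->
  ([set c | x (ch c).1 <= xi] \subset [set c | x (ch c).1 <= xi']) &&
  ([set c | x (ch c).2 < xi] \subset [set c | x (ch c).2 < xi']).
Proof.
move=> le_xi; apply/andP; split; apply/subsetP => c; rewrite !inE => h.
  exact: le_trans h le_xi.
exact: lt_le_trans h le_xi.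
Qed.

Lemma slab_mono ch xi xi' : xi <= xi' -> (slab ch xi <= slab ch xi')%N.
Proof.
by case/(slab_sets ch)/andP => /subset_leq_card h1 /subset_leq_card h2; apply: leq_add.
Qed.

Lemma slab_active ch xi xi' c :
  slab ch xi = slab ch xi' -> active ch c xi = active ch c xi'.
Proof.
wlog le_xi : xi xi' / xi <= xi'.
  move=> wl e; case: (leP xi xi') => [/wl->//|/ltW/wl ->//].
have /andP[s1 s2] := slab_sets ch le_xi; move=> e.
have sum_eq (a b a' b' : nat) : (a + b = a' + b')%N -> (a <= a')%N ->
  (b <= b')%N -> (a' <= a)%N /\ (b' <= b)%N by lia.
have [c1 c2] := sum_eq _ _ _ _ e (subset_leq_card s1) (subset_leq_card s2).
have /setP e1 : [set c | x (ch c).1 <= xi] = [set c | x (ch c).1 <= xi'].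
  by apply/eqP; rewrite eqEcard s1.
have /setP e2 : [set c | x (ch c).2 < xi] = [set c | x (ch c).2 < xi'].
  by apply/eqP; rewrite eqEcard s2.
rewrite /active; have := e1 c; have := e2 c; rewrite !inE => e2c ->.
by rewrite !(leNgt _ (x _)) e2c.
Qed.

Lemma same_block_sym ch St p q : same_block ch St p q = same_block ch St q p.
Proof.
rewrite /same_block eq_sym; case: eqP => //= e; apply: eq_forallb => z.
by rewrite e [X in _ ==> (_ ==> X)]eq_sym.
Qed.

Lemma same_block_trans ch St : transitive (same_block ch St).
Proof.
move=> q p r /andP[/eqP e1 /forall_inP h1] /andP[/eqP e2 /forall_inP h2].
rewrite /same_block e1 e2 eqxx; apply/forall_inP => z Sz; apply/implyP => cz.
have := h1 z Sz; have := h2 z Sz; rewrite e1 e2 cz /= => /eqP <- /eqP ->.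
by [].
Qed.

(** One point per cell, which serves to count the cells and to name them. *)
Definition leftmost ch : {set T} :=
  [set p | [forall q, (cell ch q == cell ch p) ==> (x p <= x q)]].

Lemma leftmost_exists ch p :
  exists2 z, z \in leftmost ch & cell ch z = cell ch p /\ x z <= x p.
Proof.
have := @Order.TotalTheory.arg_minP _ _ _ p (fun q => cell ch q == cell ch p) x (eqxx _).
case=> z /eqP cz le_z; exists z; last by split=> //; apply: le_z; rewrite eqxx.
by rewrite inE; apply/forallP => q; rewrite cz; apply/implyP => /le_z.
Qed.

Lemma card_leftmost ch : (#|leftmost ch| <= (4 * s + 1) * (2 * s + 1))%N.
Proof.
have card_le (A : {set cluster}) : (#|A| <= 2 * s)%N.
  by rewrite (leq_trans (max_card _)) // card_prod card_bool card_ord.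
have slab_lt xi : (slab ch xi < 4 * s + 1)%N.
  by apply: leq_ltn_trans (leq_add (card_le _) (card_le _)) _; lia.
have below_lt p : (#|below ch p| < 2 * s + 1)%N.
  by have := card_le (below ch p); lia.
pose f p := (Ordinal (slab_lt (x p)), Ordinal (below_lt p)).
have inj_f : {in leftmost ch &, injective f}.
  move=> p q; rewrite !inE => /forallP hp /forallP hq [e1 e2].
  have epq : cell ch p = cell ch q by rewrite /cell e1 e2.
  apply: injx; apply/eqP; rewrite eq_le.
  by have := hp q; have := hq p; rewrite epq eqxx /= => -> ->.
by rewrite -(card_in_imset inj_f) (leq_trans (max_card _)) // card_prod !card_ord.
Qed.

Lemma block_head ch St p : leftmost ch \subset St ->
  exists2 z, z \in St & same_block ch St p z.
Proof.
move=> /subsetP lSt; have [z0 /lSt Sz0 [c0 le0]] := leftmost_exists ch p.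
have := @Order.TotalTheory.arg_maxP _ _ _ z0
  (fun z => [&& z \in St, cell ch z == cell ch p & x z <= x p]) x.
rewrite Sz0 c0 eqxx le0 => /(_ isT)[z /and3P[Sz /eqP cz le_z] max_z].
exists z => //; rewrite /same_block cz eqxx; apply/forall_inP => w Sw.
apply/implyP => cw; apply/eqP; apply/idP/idP => [le_w|/le_trans-> //].
by apply: max_z; rewrite Sw cw.
Qed.

Lemma block_head_uniq ch St z z' :
  z \in St -> z' \in St -> same_block ch St z z' -> z = z'.
Proof.
move=> Sz Sz' /andP[/eqP cz /forall_inP h]; apply: injx; apply/eqP.
rewrite eq_le; have := h _ Sz; have := h _ Sz'.
by rewrite cz eqxx /= lexx => /eqP -> /eqP <-; rewrite lexx.
Qed.

(** Each block contains at most one point of St, so the set of all values of o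
    on St meets the block of z in the value at z only. *)
Lemma pick_block ch St (o : T -> option T) p z :
  z \in St -> same_block ch St p z ->
  (forall z u, o z = Some u -> same_block ch St z u) ->
  [pick u in [set u | [exists z in St, o z == Some u]] | same_block ch St p u] = o z.
Proof.
move=> Sz pz ho; case: pickP => [u|noU].
  rewrite inE => /andP[/exists_inP[z' Sz' /eqP oz'] pu].
  suff -> : z = z' by [].
  apply: block_head_uniq Sz Sz' _; apply: same_block_trans (_ : same_block ch St z p) _.
    by rewrite same_block_sym.
  by apply: same_block_trans pu _; rewrite same_block_sym; apply: ho.
case oz : (o z) => [u|//]; have := noU u.
rewrite inE (same_block_trans pz (ho _ _ oz)) andbT => /negbT/negP[].
by apply/exists_inP; exists z => //; rewrite oz.
Qed.

Lemma card_block_values St (o : T -> option T) :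
  (#|[set u | [exists z in St, o z == Some u]]| <= #|St|)%N.
Proof.
apply: leq_trans (leq_imset_card (fun z => odflt z (o z)) St).
apply: subset_leq_card; apply/subsetP => u; rewrite inE.
by move=> /exists_inP[z Sz /eqP oz]; apply/imsetP; exists z; rewrite ?oz.
Qed.

(** A colouring is given with a cluster [cls p] for each point p, the colour
    being the first component.  Different clusters of one colour may overlap. *)
Section Coloured.
Variables (ch : {ffun cluster -> T * T}) (W : cluster -> R -> R -> Prop).
Variable cls : T -> cluster.
Hypothesis W_convex : forall c, convex2 (W c).
Hypothesis W_disjoint : forall c d u v, c.1 != d.1 -> W c u v -> W d u v -> False.
Hypothesis W_cls : forall p, W (cls p) (x p) (y p).
Hypothesis W_ends : forall c, W c (x (ch c).1) (y (ch c).1) /\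
                              W c (x (ch c).2) (y (ch c).2).
Hypothesis cls_active : forall p, active ch (cls p) (x p).

Let col p := (cls p).1.

Lemma W_chord c xi : active ch c xi -> W c xi (chord ch c xi).
Proof.
rewrite /active /chord; have [] := W_ends c.
set l := (ch c).1; set r := (ch c).2 => Wl Wr /andP[le_l le_r].
have [elr|neq] := eqVneq (x l) (x r).
  have -> : xi = x l by apply/eqP; rewrite eq_le {1}elr le_l le_r.
  by rewrite subrr mul0r addr0.
have lt_lr : x l < x r by rewrite lt_neqAle neq (le_trans le_l le_r).
pose t := (xi - x l) / (x r - x l).
have t01 : 0 <= t <= 1 by rewrite divr_ge0 ?ler_pdivrMr /=; lra.
have := W_convex Wl Wr t01.
have -> : (1 - t) * x l + t * x r = xi by rewrite /t; field; lra.
by have -> : (1 - t) * y l + t * y r = y l + (xi - x l) * ((y r - y l) / (x r - x l))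
  by rewrite /t; field; lra.
Qed.

Lemma over_or c d xi : c.1 != d.1 -> active ch c xi -> active ch d xi ->
  over (W c) (W d) \/ over (W d) (W c).
Proof.
move=> cd /W_chord Wc /W_chord Wd.
have dis u v : W c u v -> W d u v -> False by apply: W_disjoint.
case: (ltgtP (chord ch c xi) (chord ch d xi)) => [lt|lt|e].
- right; apply: over_of_pair Wd Wc lt => // u v Wd' Wc'; exact: dis Wc' Wd'.
- by left; apply: over_of_pair Wc Wd lt.
- by case: (dis xi (chord ch c xi)); rewrite // e.
Qed.

(** A chord below q is below p as well: if it has the colour of p, it is under
    the cluster of q, which is under p; if it has the colour of q, it cannot
    be over the cluster of p, which is over q, so it is under it. *)
Lemma over_below p q :
  slab ch (x p) = slab ch (x q) -> col p != col q ->
  over (W (cls p)) (W (cls q)) ->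
  [/\ below ch q \subset below ch p, cls q \in below ch p & cls p \notin below ch q].
Proof.
move=> epq cpq ov.
have act c : active ch c (x p) = active ch c (x q) by apply: slab_active.
have aqp : active ch (cls q) (x p) by rewrite act cls_active.
have apq : active ch (cls p) (x q) by rewrite -act cls_active.
have q_lt : chord ch (cls q) (x p) < y p := ov _ _ _ (W_cls p) (W_chord aqp).
have p_gt : y q < chord ch (cls p) (x q) := ov _ _ _ (W_chord apq) (W_cls q).
split; last 2 first.
- by rewrite inE aqp.
- by rewrite inE apq /= -leNgt ltW.
apply/subsetP => c; rewrite !inE => /andP[ac lt_c].
rewrite act ac /=.
have acp : active ch c (x p) by rewrite act.
case: (eqVneq c.1 (col p)) => [cp|cp].
  have [ov'|ov'] : over (W c) (W (cls q)) \/ over (W (cls q)) (W c).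
  - by apply: over_or ac (cls_active q); rewrite cp.
  - by have := ov' _ _ _ (W_chord ac) (W_cls q); lra.
  have := ov' _ _ _ (W_chord aqp) (W_chord acp); lra.
have [ov'|ov'] : over (W c) (W (cls p)) \/ over (W (cls p)) (W c).
- exact: over_or ac apq.
- by have := ov' _ _ _ (W_chord ac) (W_chord apq); lra.
exact: ov' (W_cls p) (W_chord acp).
Qed.

Lemma cell_slab p q : cell ch p = cell ch q -> slab ch (x p) = slab ch (x q).
Proof. by case. Qed.

Lemma cell_over p q : cell ch p = cell ch q -> col p != col q ->
  over (W (cls p)) (W (cls q)) \/ over (W (cls q)) (W (cls p)).
Proof.
move=> /cell_slab epq cpq; apply: (@over_or _ _ (x p)) => //.
by rewrite (slab_active _ epq).
Qed.

(** [over_below] gives an inclusion between two sets that have the same size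
    when the points are in the same cell. *)
Lemma cell_below p q : cell ch p = cell ch q -> col p != col q ->
  below ch p = below ch q.
Proof.
move=> epq cpq; have es := cell_slab epq.
have ecard : #|below ch p| = #|below ch q| by case: epq.
case: (cell_over epq cpq) => ov.
  have [sub _ _] := over_below es cpq ov.
  by apply/esym/eqP; rewrite eqEcard sub ecard leqnn.
have [|sub _ _] := over_below (esym es) _ ov; first by rewrite eq_sym.
by apply/eqP; rewrite eqEcard sub ecard leqnn.
Qed.

(** By [cell_below] the four points have the same set of chords below them, and
    by [over_below] this set contains the lower cluster and not the upper
    cluster of any pair of opposite colours.  Comparing p with q' then excludes
    the opposite order for p' and q'. *)
Lemma cell_orientation p q p' q' :
  cell ch q = cell ch p -> cell ch p' = cell ch p -> cell ch q' = cell ch p ->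
  col p' = col p -> col q' = col q -> col p != col q ->
  over (W (cls p)) (W (cls q)) -> over (W (cls p')) (W (cls q')).
Proof.
move=> eq ep' eq' cp' cq' cpq ov.
have qp' : cell ch p' = cell ch q' by rewrite ep' eq'.
have cpq' : col p' != col q' by rewrite cp' cq'.
have cpq2 : col p != col q' by rewrite cq'.
case: (cell_over qp' cpq') => // ov'.
have b1 := cell_below (esym eq) cpq.
have b2 := cell_below (esym eq') cpq2.
have b3 := cell_below qp' cpq'.
have [_ _ h1] := over_below (cell_slab (esym eq)) cpq ov.
have [|_ _ h2] := over_below (cell_slab (esym qp')) _ ov'; first by rewrite eq_sym.
case: (cell_over (esym eq') cpq2) => ov2.
  have [_ h _] := over_below (cell_slab (esym eq')) cpq2 ov2.
  by rewrite b3 -b2 h in h2.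
have [|_ h _] := over_below (cell_slab eq') _ ov2; first by rewrite eq_sym.
by rewrite -b1 b2 h in h1.
Qed.

(** The last condition is the computable form of the cluster of a being over
    the cluster of b. *)
Definition orient p :=
  [exists a, exists b, [&& cell ch a == cell ch p, cell ch b == cell ch p,
                           col a, ~~ col b & chord ch (cls b) (x a) < y a]].

Definition upper p := col p == orient p.

Lemma orient_cell p q : cell ch p = cell ch q -> orient p = orient q.
Proof. by rewrite /orient => ->. Qed.

Lemma upper_over p q : cell ch p = cell ch q -> upper p -> ~~ upper q ->
  over (W (cls p)) (W (cls q)).
Proof.
move=> epq; rewrite /upper -(orient_cell epq).
have act a b : cell ch a = cell ch b -> active ch (cls b) (x a).
  by move=> e; rewrite (slab_active _ (cell_slab e)).
case op: (orient p) => /eqP cp /negPf cq.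
  have {}cq : col q = false by move: cq; case: (col q).
  case/existsP: op => a /existsP[b].
  case/and5P => /eqP ea /eqP eb ca /negPf cb lt_ba.
  have eab : cell ch a = cell ch b by rewrite ea eb.
  apply: (cell_orientation (p := a) (q := b)); rewrite ?ca ?cb ?eb -?epq ?ea //.
  case: (@cell_over a b) => //; first by rewrite ca cb.
  move=> ov; have := ov _ _ _ (W_chord (act _ _ eab)) (W_cls a); lra.
have {}cq : col q = true by move: cq; case: (col q).
case: (@cell_over p q) => //; first by rewrite cp cq.
move=> ov; have := ov _ _ _ (W_cls q) (W_chord (act _ _ (esym epq))) => lt.
suff : orient p by rewrite op.
by apply/existsP; exists q; apply/existsP; exists p; rewrite epq !eqxx cp cq.
Qed.

Let in_cell_crossed (t : T * T * T) :=
  [&& cell ch t.1.1 == cell ch t.2, cell ch t.1.2 == cell ch t.2 &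
      crossed x y upper t.1.1 t.1.2 t.2].

(** Triples in different slabs are far apart.  In the same slab, having
    the cluster of q in common forces the same chords below, hence the same
    cell: each p lies over the cluster of the other q too (or under it), so
    [over_below] gives both inclusions. *)
Lemma same_type_far t t' :
  in_cell_crossed t -> in_cell_crossed t' ->
  upper t.1.2 = upper t'.1.2 -> cls t.1.2 = cls t'.1.2 ->
  cell ch t.2 != cell ch t'.2 -> (x t.2 <= x t'.1.1) || (x t'.2 <= x t.1.1).
Proof.
case: t => [[p q] r]; case: t' => [[p' q'] r'] /=.
case/and3P => /= /eqP ep /eqP eq /and5P[pq qr /eqP upr uqp _].
case/and3P => /= /eqP ep' /eqP eq' /and5P[pq' qr' /eqP upr' uqp' _].
move=> euq ecq; apply: contraR; rewrite negb_or -!ltNge => /andP[lt1 lt2].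
have es : slab ch (x r) = slab ch (x r').
  apply/eqP; rewrite eqn_leq -{1}(cell_slab ep) -{2}(cell_slab ep').
  by rewrite !slab_mono // ltW.
have eqp : cell ch q = cell ch p by rewrite eq ep.
have eqp' : cell ch q' = cell ch p' by rewrite eq' ep'.
have ncol a b : cell ch a = cell ch b -> upper a != upper b -> col a != col b.
  by rewrite /upper => /orient_cell ->; apply: contraNneq => ->.
have cqp := ncol _ _ eqp uqp; have cqp' := ncol _ _ eqp' uqp'.
have bqp := cell_below eqp cqp; have bqp' := cell_below eqp' cqp'.
have ecol : col q = col q' by rewrite /col ecq.
have s1 : slab ch (x p) = slab ch (x q').
  by rewrite (cell_slab ep) es (cell_slab eq').
have s2 : slab ch (x p') = slab ch (x q).
  by rewrite (cell_slab ep') -es (cell_slab eq).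
have sub : below ch q = below ch q'.
  apply/eqP; rewrite eqEsubset.
  have cqp2 : col p != col q' by rewrite -ecol eq_sym.
  have cqp2' : col p' != col q by rewrite ecol eq_sym.
  case uq : (upper q).
    have uq' : upper q' by rewrite -euq.
    have up0 : ~~ upper p by move: uqp; rewrite uq; case: (upper p).
    have up0' : ~~ upper p' by move: uqp'; rewrite uq'; case: (upper p').
    have := upper_over eqp uq up0; have := upper_over eqp' uq' up0'.
    rewrite -ecq {2}ecq => ov' ov.
    have [|h _ _] := over_below (esym s1) _ ov; first by rewrite eq_sym.
    have [|h' _ _] := over_below (esym s2) _ ov'; first by rewrite eq_sym.
    by rewrite {1}bqp h /= bqp' h'.
  have uq' : ~~ upper q' by rewrite -euq uq.
  have up0 : upper p by move: uqp; rewrite uq; case: (upper p).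
  have up0' : upper p' by move: uqp'; rewrite (negPf uq'); case: (upper p').
  have := upper_over (esym eqp) up0 (negbT uq).
  have := upper_over (esym eqp') up0' uq'.
  rewrite -ecq {2}ecq => ov' ov.
  have [h _ _] := over_below s1 cqp2 ov.
  have [h' _ _] := over_below s2 cqp2' ov'.
  by rewrite {2}bqp h andbT bqp' h'.
by rewrite -eq -eq' /cell sub (cell_slab eq) es (cell_slab eq').
Qed.

(** [interlaced_card] for the lines separating the cluster c from the clusters
    of the ends of the triples; if the middle points are on the upper side,
    the picture is turned upside down by changing the sign of y. *)
Lemma type_card (S : {set T * T * T}) (w : bool) (c : cluster) :
  {in S, forall t, in_cell_crossed t} ->
  {in S &, forall t t', t != t' -> cell ch t.2 = cell ch t'.2 ->
     (x t.2 <= x t'.1.1) || (x t'.2 <= x t.1.1)} ->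
  {in S, forall t, upper t.1.2 = w /\ cls t.1.2 = c} -> (#|S| <= s)%N.
Proof.
move=> SX Sdisj Stype.
(* the indices of the clusters that occur at the ends of the triples *)
pose D := [pred i | [exists t in S, ((cls t.1.1).2 == i) || ((cls t.2).2 == i)]].
pose y' z := if w then - y z else y z.
pose P i := [pred p | cls p == (~~ c.1, i)].
pose Q := [pred q | cls q == c].
have cN a b : cell ch a = cell ch b -> upper a != upper b -> col a = ~~ col b.
  rewrite /upper => /orient_cell ->.
  by case: (col a); case: (col b); case: (orient b).
have SP t : t \in S -> [/\ cls t.1.1 = (~~ c.1, (cls t.1.1).2),
    cls t.2 = (~~ c.1, (cls t.2).2) &
    forall p, p = t.1.1 \/ p = t.2 ->
    if w then over (W c) (W (cls p)) else over (W (cls p)) (W c)].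
  move=> St; have [uw <-] := Stype _ St.
  have /and3P[/eqP e1 /eqP e2 /and5P[_ _ /eqP upr uqp _]] := SX _ St.
  have e12 : cell ch t.1.1 = cell ch t.1.2 by rewrite e1 e2.
  have uqr : upper t.2 != upper t.1.2 by rewrite -upr eq_sym.
  rewrite eq_sym in uqp.
  split.
  - by rewrite [LHS]surjective_pairing; congr (_, _); exact: cN uqp.
  - by rewrite [LHS]surjective_pairing; congr (_, _); apply: cN uqr.
  - move=> p pP.
    have ep : cell ch p = cell ch t.1.2 by case: pP => ->; rewrite ?e12 ?e2.
    have : upper p != upper t.1.2 by case: pP => ->.
    move: uw; case: (w) => uw; rewrite uw => np.
      by apply: upper_over; rewrite ?uw //; case: (upper p) np.
    by apply: upper_over; rewrite ?uw //; case: (upper p) np.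
have /fin_all_exists[ab abP] : forall i : 'I_s, exists ab : R * R, i \in D ->
    {in P i, forall p, ab.1 * x p + ab.2 < y' p} /\
    {in Q, forall q, y' q < ab.1 * x q + ab.2}.
  move=> i; case: (boolP (i \in D)) => [|_]; last by exists (0, 0).
  case/exists_inP => t St ti; have [e1 e2 ov] := SP _ St.
  have {}ov : if w then over (W c) (W (~~ c.1, i)) else over (W (~~ c.1, i)) (W c).
    case/orP: ti => /eqP <-.
      by rewrite -e1; apply: ov; left.
    by rewrite -e2; apply: ov; right.
  have neq p q : p \in P i -> q \in Q -> x p != x q.
    rewrite !inE => /eqP ep /eqP eq; apply: contraTneq isT => /injx epq.
    by have := congr1 fst ep; rewrite epq eq /=; case: (c.1).
  have PW p : p \in P i -> W (~~ c.1, i) (x p) (y p).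
    by rewrite inE => /eqP <-; apply: W_cls.
  have QW q : q \in Q -> W c (x q) (y q) by rewrite inE => /eqP <-; apply: W_cls.
  rewrite /y'; case: (w) ov => ov.
    have [|a [b [hQ hP]]] := over_separating_line _ QW PW (@W_convex _) (@W_convex _) ov.
      by move=> q p hq hp; rewrite eq_sym neq.
    exists (- a, - b) => _; split=> [p /hP|q /hQ] /=; lra.
  have [a [b [hP hQ]]] := over_separating_line neq PW QW (@W_convex _) (@W_convex _) ov.
  by exists (a, b).
rewrite -[X in (_ <= X)%N]card_ord.
apply: (@interlaced_card _ _ x y' _ D (fun i => (ab i).1) (fun i => (ab i).2)
   (fun p => (cls p).2)).
- move=> p q r St; have := SX _ St; have [/= uw _] := Stype _ St.
  case/and3P => _ _ /and5P[/= -> -> _ _]; rewrite uw => hq; split=> //.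
  + by move: hq; rewrite /height /y'; case: (w); lra.
  + by apply/exists_inP; exists (p, q, r); rewrite //= eqxx.
  + by apply/exists_inP; exists (p, q, r); rewrite //= eqxx orbT.
- move=> p q r St; have [/= e1 e2 _] := SP _ St; have [/= _ ec] := Stype _ St.
  have Dp : (cls p).2 \in D by apply/exists_inP; exists (p, q, r); rewrite //= eqxx.
  have Dr : (cls r).2 \in D by apply/exists_inP; exists (p, q, r); rewrite //= eqxx orbT.
  split.
  + by have [h _] := abP _ Dp; apply: h; rewrite inE {1}e1.
  + by have [h _] := abP _ Dr; apply: h; rewrite inE {1}e2.
  + by move=> i /abP[_ h]; apply: h; rewrite inE ec.
- move=> t t' St St' neq; case: (eqVneq (cell ch t.2) (cell ch t'.2)) => [e|].
    exact: Sdisj.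
  have [u1 c1] := Stype _ St; have [u2 c2] := Stype _ St'.
  by apply: same_type_far; rewrite ?SX ?u1 ?u2 ?c1 ?c2.
Qed.

(** Apply [type_card] to each of the 4 s types: the side and the cluster of the
    middle point. *)
Lemma crossed_selection :
  exists2 Sel : {set T * T * T}, (#|Sel| <= 4 * s ^ 2)%N &
    forall p q r, cell ch p = cell ch r -> cell ch q = cell ch r ->
      crossed x y upper p q r ->
      exists2 t, t \in Sel & cell ch t.2 = cell ch r /\ x p < x t.2 <= x r.
Proof.
pose F := [set t | in_cell_crossed t].
have [|Sel [/subsetP SF hit dis]] := @greedy_piercing R _ _
    (fun t : T * T * T => cell ch t.2) (fun t => x t.1.1) (fun t => x t.2) F.
  by move=> t; rewrite inE => /and3P[_ _ /and5P[lt1 lt2 _ _ _]]; apply: lt_trans lt2.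
exists Sel => [|p q r epr eqr X]; last first.
  have [|t St [e lt1 le2]] := hit (p, q, r).
    by rewrite inE /in_cell_crossed /= epr eqr !eqxx.
  by exists t => //; split=> //; apply/andP.
rewrite -sum1_card (partition_big (fun t : T * T * T => (upper t.1.2, cls t.1.2)) predT) //=.
apply: (@leq_trans (\sum_(w : bool * cluster) s)%N).
  apply: leq_sum => -[w c] _; rewrite sum1dep_card.
  apply: (@type_card _ w c).
  - by move=> t; rewrite inE => /andP[/SF]; rewrite inE.
  - by move=> t t'; rewrite !inE => /andP[St _] /andP[St' _]; apply: dis.
  - by move=> t; rewrite inE => /andP[_ /eqP[-> ->]].
by rewrite sum_nat_const !card_prod card_bool card_ord !mulnA -mulnA mulnn.
Qed.

(** There are at most 4 s ^ 2 cuts and (4 s + 1) (2 s + 1) <= 15 s ^ 2 cells,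
    which accounts for 19 s ^ 2. *)
Lemma colouring_decoded : (0 < s)%N ->
  exists St Fi U V : {set T},
    [/\ (#|St| <= 19 * s ^ 2)%N, (#|Fi| <= 19 * s ^ 2)%N,
        (#|U| <= 19 * s ^ 2)%N, (#|V| <= 19 * s ^ 2)%N &
        col =1 decode ch St Fi U V].
Proof.
move=> s0; have [Sel cSel hit] := crossed_selection.
pose St := [set t.2 | t in Sel] :|: leftmost ch.
pose Fi := [set p in leftmost ch | orient p].
have cL : (#|leftmost ch| <= 15 * s ^ 2)%N.
  by apply: leq_trans (card_leftmost _) _; rewrite -mulnn; nia.
have cSt : (#|St| <= 19 * s ^ 2)%N.
  apply: leq_trans (leq_card_setU _ _) _.
  apply: leq_trans (leq_add (leq_trans (leq_imset_card _ _) cSel) cL) _.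
  by rewrite -mulnDl.
have lSt : leftmost ch \subset St by apply: subsetUr.
have /fin_all_exists[o oP] : forall z, exists o : option T * option T,
    [/\ forall u, o.1 = Some u -> same_block ch St z u,
        forall v, o.2 = Some v -> same_block ch St z v &
        forall p, same_block ch St z p -> upper p = reads x y o p].
  move=> z; have [|o [h1 h2 h3]] :=
      @reads_uncrossed R T x y [set p | same_block ch St z p] upper injx.
    move=> p q r; rewrite !inE => zp zq zr; apply/negP => X.
    have pr : same_block ch St p r.
      by apply: same_block_trans zr; rewrite same_block_sym.
    have e1 : cell ch p = cell ch r by case/andP: pr => /eqP.
    have e2 : cell ch q = cell ch r.
      by case/andP: zq => /eqP <- _; case/andP: zr => /eqP.
    have [t tS [e3 /andP[lt1 le2]]] := hit _ _ _ e1 e2 X.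
    case/andP: pr => _ /forall_inP/(_ t.2).
    rewrite inE imset_f // e1 e3 eqxx le2 leNgt lt1 => /(_ isT) //.
  exists o; split=> [u /h1|v /h2|p zp]; rewrite ?inE //.
  by apply: h3; rewrite inE.
exists St, Fi, [set u | [exists z in St, (o z).1 == Some u]],
               [set v | [exists z in St, (o z).2 == Some v]].
split=> //.
- apply: leq_trans (subset_leq_card _) (leq_trans cL _); last by rewrite leq_mul2r orbT.
  by apply/subsetP => p; rewrite inE => /andP[].
- exact: leq_trans (card_block_values _ (fun z => (o z).1)) cSt.
- exact: leq_trans (card_block_values _ (fun z => (o z).2)) cSt.
move=> p; have [z Sz pz] := block_head p lSt.
rewrite /decode (@pick_block _ _ (fun z => (o z).1) p z) //; last first.
  by move=> z' u; case: (oP z') => h _ _; apply: h.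
rewrite (@pick_block _ _ (fun z => (o z).2) p z) //; last first.
  by move=> z' u; case: (oP z') => _ h _; apply: h.
rewrite -surjective_pairing.
have [_ _ <-] := oP z; last by rewrite same_block_sym.
suff -> : [exists z0 in Fi, cell ch z0 == cell ch p] = orient p.
  by rewrite /upper; case: (col p); case: (orient p).
apply/exists_inP/idP => [[z0]|op].
  by rewrite inE => /andP[_ oz] /eqP /orient_cell <-.
have [z0 lz0 [cz0 _]] := leftmost_exists ch p.
exists z0; last by rewrite cz0.
by rewrite inE (orient_cell cz0) op andbT.
Qed.

End Coloured.
End Cells.

(** * Counting separable colourings *)

Section SeparableColourings.
Variables (R : realFieldType) (T : finType) (x y : T -> R) (s : nat).
Hypothesis injx : injective x.

Definition separable (X : {set T}) :=
  exists W : bool -> 'I_s -> R -> R -> Prop,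
    [/\ forall b i, convex2 (W b i),
        forall i j u v, W true i u v -> W false j u v -> False &
        forall p, exists i, W (p \in X) i (x p) (y p)].

(** A convex set that is not used as the cluster of any point is replaced by one
    that is used for the same colour, so that every cluster has a chord; this
    is where both colours must occur. *)
Lemma separable_decoded (X : {set T}) : (0 < s)%N ->
  X != set0 -> X != setT -> separable X ->
  exists (ch : {ffun bool * 'I_s -> T * T}) (St Fi U V : {set T}),
    [/\ (#|St| <= 19 * s ^ 2)%N, (#|Fi| <= 19 * s ^ 2)%N,
        (#|U| <= 19 * s ^ 2)%N, (#|V| <= 19 * s ^ 2)%N &
        X = [set p | decode x y ch St Fi U V p]].
Proof.
move=> s0 X0 XT [W0 [W0_convex W0_disj /fin_all_exists[cl W0_cl]]].
have [pt ptX] : exists pt : bool -> T, forall b, (pt b \in X) = b.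
  case/set0Pn: X0 => p1 X1.
  have [p0 /negbTE nX0] : exists p0, p0 \notin X.
    apply/existsP; apply: contraNT XT; rewrite negb_exists => /forallP h.
    by apply/eqP/setP => p; rewrite inE; have := h p; rewrite negbK.
  by exists (fun b => if b then p1 else p0) => -[].
pose cls p := (p \in X, cl p).
(* a point whose cluster replaces c; the cluster of that point is c if c is used *)
pose rep c := odflt (pt c.1) [pick p | cls p == c].
have rep_col c : (cls (rep c)).1 = c.1.
  by rewrite /rep; case: pickP => [p /eqP -> //|_] /=; rewrite ptX.
have rep_cls p : cls (rep (cls p)) = cls p.
  by rewrite {1}/rep; case: pickP => [q /eqP -> //|/(_ p)]; rewrite eqxx.
have /fin_all_exists[ends endsP] : forall c, exists lr : T * T,
    [/\ cls lr.1 = cls (rep c), cls lr.2 = cls (rep c) &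
        forall q, cls q = cls (rep c) -> x lr.1 <= x q <= x lr.2].
  move=> c; pose P := [pred q | cls q == cls (rep c)].
  have Pc : P (rep c) by rewrite inE.
  case: (Order.TotalTheory.arg_minP x Pc) => l /eqP cl_l min_l.
  case: (Order.TotalTheory.arg_maxP x Pc) => r /eqP cl_r max_r.
  exists (l, r); split=> // q /eqP cq.
  by apply/andP; split; [apply: min_l | apply: max_r].
pose W c := W0 c.1 (cls (rep c)).2.
have W_pt p : W0 (cls p).1 (cls p).2 (x p) (y p) by apply: W0_cl.
have [|||||St [Fi [U [V [cSt cFi cU cV dec]]]]] :=
    @colouring_decoded R T x y s injx (finfun ends) W cls _ _ _ _ _ s0.
- by move=> c; apply: W0_convex.
- move=> [[] i] [[] j] u v //= _ h1 h2; first exact: W0_disj h1 h2.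
  exact: W0_disj h2 h1.
- by move=> p; rewrite /W rep_cls; apply: W_pt.
- move=> c; rewrite ffunE; have [e1 e2 _] := endsP c.
  by rewrite /W -(rep_col c); split; [rewrite -e1 | rewrite -e2]; apply: W_pt.
- move=> p; rewrite /active ffunE; have [_ _ h] := endsP (cls p).
  by apply: h; rewrite rep_cls.
exists (finfun ends), St, Fi, U, V; split=> //.
by apply/setP => p; rewrite inE -dec.
Qed.

(** The chords contribute 2 ^ (48 m), each of the four subsets 2 ^ (127 m), and
    2 stands for the two colourings with only one colour. *)
Lemma code_count m : (0 < s)%N -> m = (s ^ 2)%N -> #|T| = (672 * m)%N ->
  ((#|T| * #|T|) ^ (2 * s) * (2 ^ (127 * m)) ^ 4 + 2 < 2 ^ #|T|)%N.
Proof.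
move=> s0 em cT.
have h1 : (#|T| <= 2 ^ (10 + 2 * s))%N.
  rewrite cT em expnD; apply: leq_mul => //.
  by rewrite mulnC expnM leq_exp2r // ltnW // ltn_expl.
have h2 : ((#|T| * #|T|) ^ (2 * s) <= 2 ^ (48 * m))%N.
  apply: (@leq_trans ((2 ^ (10 + 2 * s) * 2 ^ (10 + 2 * s)) ^ (2 * s))%N).
    by rewrite leq_exp2r ?muln_gt0 // leq_mul.
  by rewrite -expnD -expnM leq_exp2l // em -mulnn; nia.
apply: (@leq_ltn_trans (2 ^ (556 * m) + 2)%N).
  rewrite leq_add2r -expnM; apply: leq_trans (leq_mul h2 (leqnn _)) _.
  by rewrite -expnD leq_exp2l //; lia.
have m0 : (0 < m)%N by rewrite em expn_gt0 s0.
apply: (@leq_ltn_trans (2 ^ (556 * m) * 2)%N).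
  rewrite muln2 -addnn leq_add2l -{1}(expn1 2) leq_exp2l //; lia.
by rewrite -expnSr ltn_exp2l // cT; lia.
Qed.

Lemma unseparable_exists : (0 < s)%N -> #|T| = (672 * s ^ 2)%N ->
  exists X : {set T}, [/\ X != set0, X != setT & ~ separable X].
Proof.
move=> s0 cT; apply: contrapT => noX.
have allsep X : X != set0 -> X != setT -> separable X.
  by move=> h1 h2; apply: contrapT => h3; apply: noX; exists X.
pose small := [set A : {set T} | (#|A| <= 19 * s ^ 2)%N].
pose code := ({ffun bool * 'I_s -> T * T} *
  (({set T} * {set T}) * ({set T} * {set T})))%type.
pose dec (c : code) :=
  [set p | decode x y c.1 c.2.1.1 c.2.1.2 c.2.2.1 c.2.2.2 p].
pose D := [set X : {set T} | (X != set0) && (X != setT)].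
pose good : {set code} :=
  setX [set: {ffun bool * 'I_s -> T * T}]
       (setX (setX small small) (setX small small)).
have sub : D \subset [set dec c | c in good].
  apply/subsetP => X; rewrite inE => /andP[X0 XT].
  have [ch [St [Fi [U [V [h1 h2 h3 h4 eX]]]]]] :=
    separable_decoded s0 X0 XT (allsep X X0 XT).
  apply/imsetP; exists (ch, ((St, Fi), (U, V))) => //.
  by rewrite !inE /= h1 h2 h3 h4.
have cD : #|D| = (2 ^ #|T| - 2)%N.
  have -> : D = ~: [set set0; setT].
    by apply/setP => X; rewrite !inE negb_or.
  rewrite cardsCs setCK cards2.
  have T0 : (0 < #|T|)%N by rewrite cT muln_gt0 expn_gt0 s0.
  have -> : set0 != setT :> {set T}.
    by rewrite eq_sym -card_gt0 cardsT.
  by rewrite -cardsT -powersetT card_powerset cardsT.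
have := leq_trans (subset_leq_card sub) (leq_imset_card dec good).
rewrite cD !cardsX cardsT card_ffun !card_prod card_bool card_ord.
have : (#|small| <= 2 ^ (127 * s ^ 2))%N.
  have -> : (127 * s ^ 2 = 5 * (19 * s ^ 2) + 32 * s ^ 2)%N by lia.
  by apply: card_small_sets_pow2; rewrite cT; lia.
have := code_count s0 erefl cT.
set N := (_ ^ _)%N; set B := (2 ^ (127 * _))%N; set C := (2 ^ #|T|)%N.
move=> h1 h2 h3.
have : (N * (#|small| * #|small| * (#|small| * #|small|)) <= N * B ^ 4)%N.
  have -> : (B ^ 4 = B * B * (B * B))%N by rewrite (expnM _ 2 2) -!mulnn.
  by rewrite leq_mul // !leq_mul.
lia.
Qed.

End SeparableColourings.

(** * The quadratic upper bound *)

From mathcomp Require Import finmap interval_inference classical_sets convex.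

Section Upper.
Variable R : realType.
Local Open Scope classical_set_scope.

Lemma convex_setP (V : lmodType R) (A : set V) :
  convex_set A <->
  forall a b (t : R), A a -> A b -> 0 <= t <= 1 -> A (t *: a + (1 - t) *: b).
Proof.
split=> [cA a b t Aa Ab /andP[t0 t1]|cA a b t /set_mem Aa /set_mem Ab].
  have := cA a b (Itv01 t0 t1); rewrite !inE; exact.
by apply/mem_set/cA; rewrite //= ge0 le1.
Qed.

(** A value of t larger than all quotients of differences is never the one
    for which two points get the same image. *)
Lemma injective_shear (I : finType) (u v : I -> R) :
  injective (fun i => (u i, v i)) -> exists t, injective (fun i => u i + t * v i).
Proof.
move=> inj; pose r (w : I * I) := `|(u w.1 - u w.2) / (v w.1 - v w.2)|.
exists (1 + \sum_w r w) => i j eij.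
have evij : v i = v j.
  apply/eqP/negPn/negP => neq.
  have : r (i, j) <= \sum_w r w.
    by rewrite (bigD1 (i, j)) //= lerDl sumr_ge0 // => w _; rewrite normr_ge0.
  suff -> : r (i, j) = `|1 + \sum_w r w|.
    have := ler_norm (1 + \sum_w r w); lra.
  rewrite /r /= -[RHS]normrN; congr `|_|.
  have vij : v i - v j != 0 by rewrite subr_eq0.
  by apply: (mulIf vij); rewrite divfK //; move: eij; rewrite /r /=; lra.
by apply: inj; move: eij; rewrite evij => /addIr ->.
Qed.

(** The sets D numbered up to k, completed by empty sets up to s and read in
    the coordinates f and g. *)
Definition piece (V : Type) (f g : V -> R) (s k : nat) (D : 'I_k -> set V)
    (i : 'I_s) (u v : R) : Prop :=
  exists2 j : 'I_k, val j = val i & exists2 z, D j z & u = f z /\ v = g z.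

(** It suffices to colour 672 s ^ 2 of the points by a colouring which is not
    separable, and to put the other points into the second part. *)
Lemma s_tverberg_bound_quadratic (s : nat) : (0 < s)%N ->
  s_tverberg_bound R 2 (fun _ : 'I_2 => s) (672 * s ^ 2).
Proof.
move=> s0 P leP; set n := (672 * s ^ 2)%N in leP.
pose pt (i : 'I_n) : 'rV[R]_2 := nth 0 (enum_fset P) i.
have lt_size (i : 'I_n) : (i < size (enum_fset P))%N.
  exact: leq_trans (ltn_ord i) leP.
have ptP i : pt i \in P by apply: mem_nth.
have pt_inj : injective pt.
  move=> i j /eqP; rewrite /pt nth_uniq ?lt_size ?fset_uniq //.
  by move=> /eqP; apply: ord_inj.
have [t x_inj] : exists t, injective (fun i => pt i 0 0 + t * pt i 0 1).
  apply: injective_shear => i j [e0 e1]; apply: pt_inj; apply/rowP => k.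
  case: k => -[|[|//]] lt_k.
    by rewrite (_ : Ordinal lt_k = 0); [|apply: val_inj].
  by rewrite (_ : Ordinal lt_k = 1); [|apply: val_inj].
pose f (z : 'rV[R]_2) := z 0 0 + t * z 0 1; pose g (z : 'rV[R]_2) := z 0 1.
have fg_inj z z' : f z = f z' -> g z = g z' -> z = z'.
  rewrite /f /g => e0 e1; apply/rowP => k; case: k => -[|[|//]] lt_k.
    rewrite (_ : Ordinal lt_k = 0); last exact: val_inj.
    by move: e0; rewrite e1; apply: addIr.
  by rewrite (_ : Ordinal lt_k = 1); [|apply: val_inj].
have [X [X0 XT nsep]] := @unseparable_exists R 'I_n _ (fun i => pt i 0 1) s
   x_inj s0 (card_ord n).
pose QX : set 'rV[R]_2 := fun z => exists2 i, i \in X & z = pt i.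
pose Q (i : 'I_2) : set 'rV[R]_2 :=
  if i == ord0 then QX else fun z => z \in P /\ ~ QX z.
exists Q; split; first split.
- apply/seteqP; split=> z.
    move=> [i _]; rewrite /Q; case: (i == ord0) => [[j _ ->]|[]] //; exact: ptP.
  move=> /= zP; have [zX|zX] := pselect (QX z); first by exists ord0.
  by exists ord_max.
- apply/trivIsetP => i j _ _ neq; apply/seteqP; split=> // z [].
  have : (i == ord0) != (j == ord0).
    by move: neq; case: i => -[|[|//]] ?; case: j => -[|[|//]] ?.
  by rewrite /Q; case: (i == ord0); case: (j == ord0) => //= _; [move=> qx [_ /(_ qx)]|move=> [_ nq] /nq].
- move=> i _; rewrite /Q; case: (i == ord0).
    by case/set0Pn: X0 => j Xj; exists (pt j), j.
  have [j jX] : exists j, j \notin X.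
    apply/existsP; apply: contraNT XT; rewrite negb_exists => /forallP h.
    by apply/eqP/setP => p; rewrite inE; have := h p; rewrite negbK.
  exists (pt j); split=> // -[j' Xj' /pt_inj ej]; by rewrite ej Xj' in jX.
move=> C sC QC; apply: contrapT => noC; apply: nsep.
have [k0 [D0 [k0s D0c eC0]]] := sC ord0.
have [k1 [D1 [k1s D1c eC1]]] := sC ord_max.
have piece_convex k (D : 'I_k -> set 'rV[R]_2) (i : 'I_s) :
    (forall j, @convex_set R 'rV[R]_2 (D j)) -> convex2 (piece f g D i).
  move=> Dc _ _ _ _ r [j ji [z Dz [-> ->]]] [j' ji' [z' Dz' [-> ->]]] r01.
  have ej : j' = j by apply: val_inj; rewrite ji ji'.
  exists j => //; rewrite ej in Dz'.
  exists (r *: z' + (1 - r) *: z); last by rewrite /f /g !mxE; split; ring.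
  by have /convex_setP := Dc j; apply.
have piece_cover k (D : 'I_k -> set 'rV[R]_2) z : (k <= s)%N ->
    (exists2 j, True & D j z) -> exists i : 'I_s, piece f g D i (f z) (g z).
  move=> ks [j _ Dz]; exists (widen_ord ks j); exists j => //; by exists z.
exists (fun b => if b then piece f g D0 else piece f g D1); split.
- by case=> i; apply: piece_convex.
- move=> i j _ _ [a _ [z Da [-> ->]]] [a' _ [z' Da' [e0 e1]]].
  apply: noC; exists z => l _.
  have : l = ord0 \/ l = ord_max.
    by case: l => -[|[|//]] ?; [left | right]; apply: val_inj.
  case=> ->; first by rewrite eC0; exists a.
  by rewrite eC1; exists a'; rewrite // (fg_inj _ _ e0 e1).
- move=> p; case: (boolP (p \in X)) => Xp; apply: piece_cover => //.
    have : C ord0 (pt p) by apply: QC; exists p.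
    by rewrite eC0 => -[j _ Dj]; exists j.
  have : C ord_max (pt p).
    apply: QC; split=> // -[j Xj /pt_inj ej]; by rewrite ej Xj in Xp.
  by rewrite eC1 => -[j _ Dj]; exists j.
Qed.

End Upper.

(** * The quadratic lower bound *)

Section Lower.
Variables (R : realType) (s : nat).
Local Open Scope classical_set_scope.

(** The i-th point of the j-th arc.  The arc lies on the parabola
    Y = a ^ 2 + 2 a (X - a) - (X - a) ^ 2 with a = 4 s j, which touches the
    large parabola Y = X ^ 2 at X = a and is bent the other way. *)
Definition arc_point (w : 'I_s * 'I_s) : 'rV[R]_2 :=
  let a : R := (4 * s * w.1)%:R in let i : R := w.2%:R in
  \row_(k < 2) if k == 0 then a + i else a ^+ 2 + 2 * a * i - i ^+ 2.

(** Vanishes on the tangent to the j-th arc at its i-th point, and is positive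
    above it. *)
Definition arc_tangent (w : 'I_s * 'I_s) (z : 'rV[R]_2) : R :=
  let a : R := (4 * s * w.1)%:R in let i : R := w.2%:R in
  z 0 1 - 2 * a * z 0 0 + a ^+ 2 + 2 * i * (z 0 0 - a) - i ^+ 2.

Lemma arc_tangent_same_arc j i k :
  arc_tangent (j, i) (arc_point (j, k)) = - (k%:R - i%:R) ^+ 2.
Proof. by rewrite /arc_tangent !mxE /=; ring. Qed.

(** With m the difference of the two values of a, the value is m (m + 4 i).
    Since m is a nonzero multiple of 4 s and i < s, both factors have the
    same sign: this is why the arcs are 4 s apart. *)
Lemma arc_tangent_other_arc j j' i : j' != j ->
  0 < arc_tangent (j, i) (arc_point (j', i)).
Proof.
move=> neq; rewrite /arc_tangent !mxE /=.
set a : R := (4 * s * j)%:R; set a' : R := (4 * s * j')%:R; set t : R := i%:R.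
rewrite [X in _ < X](_ : _ = (a' - a) * (a' - a + 4 * t)); last by ring.
have t0 : 0 <= t by rewrite ler0n.
have gap (u v : 'I_s) : (u < v)%N -> (4 * s * u)%:R + 4 * t < (4 * s * v)%:R :> R.
  move=> uv; rewrite /t -natrM -natrD ltr_nat.
  have := ltn_ord i; nia.
case: (ltngtP j j') => [/gap lt|/gap lt|e].
- by apply: mulr_gt0; move: lt; rewrite -/a -/a'; lra.
- by rewrite -mulrNN; apply: mulr_gt0; move: lt; rewrite -/a -/a'; lra.
- by rewrite (val_inj e) eqxx in neq.
Qed.

Lemma arc_tangent_conv w (z z' : 'rV[R]_2) t :
  arc_tangent w (t *: z + (1 - t) *: z') =
  t * arc_tangent w z + (1 - t) * arc_tangent w z'.
Proof. by rewrite /arc_tangent !mxE; ring. Qed.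

Lemma arc_point_inj : injective arc_point.
Proof.
move=> [j i] [j' i'] /rowP/(_ 0); rewrite !mxE /= -!natrD => /eqP.
rewrite eqr_nat => /eqP e; have lti := ltn_ord i; have lti' := ltn_ord i'.
have ej : j = j' by apply: val_inj => /=; nia.
by subst j'; congr (_, _); apply: val_inj => /=; lia.
Qed.

(** The i-th points are enclosed in the intersection A i of the upper half-planes
    of the tangents at them, and the j-th arc in the intersection B j of
    the lower half-planes.  The tangent point (j, i) itself decides by its
    colour which of the two half-planes is closed. *)
Lemma s_tverberg_bound_gt N : (0 < s)%N ->
  s_tverberg_bound R 2 (fun _ : 'I_2 => s) N -> (s ^ 2 < N)%N.
Proof.
move=> s0 bN; rewrite ltnNge; apply/negP => leN.
pose pts := [seq arc_point w | w <- enum {: 'I_s * 'I_s}].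
have cP : #|` seq_fset tt pts| = (s ^ 2)%N.
  rewrite size_seq_fset undup_id; last first.
    by rewrite (map_inj_uniq arc_point_inj) enum_uniq.
  by rewrite size_map -cardE card_prod card_ord mulnn.
have [|Q [[QP /trivIsetP Qdis _] Qsep]] := bN (seq_fset tt pts); first by rewrite cP.
have Q_arc l z : Q l z -> exists w, z = arc_point w.
  move=> Qz; have zP : [set` seq_fset tt pts] z by rewrite -QP; exists l.
  have : z \in seq_fset tt pts := zP.
  by rewrite seq_fsetE => /mapP[w _ ->]; exists w.
have Q_excl z : Q ord0 z -> Q ord_max z -> False.
  move=> h0 h1; have /seteqP[sub _] := Qdis ord0 ord_max I I isT.
  exact: sub z (conj h0 h1).
pose first w := `[< Q ord0 (arc_point w) >].
pose A i (z : 'rV[R]_2) := forall j,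
  if first (j, i) then 0 <= arc_tangent (j, i) z else 0 < arc_tangent (j, i) z.
pose B j (z : 'rV[R]_2) := forall i,
  if first (j, i) then arc_tangent (j, i) z < 0 else arc_tangent (j, i) z <= 0.
have mix_ge0 (u v t : R) : 0 <= u -> 0 <= v -> 0 <= t <= 1 -> 0 <= t * u + (1 - t) * v.
  by move=> u0 v0 t01; rewrite addr_ge0 ?mulr_ge0 //; lra.
have mix_gt0 (u v t : R) : 0 < u -> 0 < v -> 0 <= t <= 1 -> 0 < t * u + (1 - t) * v.
  by move=> u0 v0 t01; nra.
have cA i : @convex_set R 'rV[R]_2 (A i).
  apply/convex_setP => z z' t Az Az' t01 j; have := Az j; have := Az' j.
  rewrite arc_tangent_conv; case: (first _) => h' h.
    exact: mix_ge0.
  exact: mix_gt0.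
have cB j : @convex_set R 'rV[R]_2 (B j).
  apply/convex_setP => z z' t Bz Bz' t01 i; have := Bz i; have := Bz' i.
  rewrite arc_tangent_conv; case: (first _) => h' h.
    by rewrite -oppr_gt0 opprD -!mulrN mix_gt0 ?oppr_gt0.
  by rewrite -oppr_ge0 opprD -!mulrN mix_ge0 ?oppr_ge0.
pose C (l : 'I_2) : set 'rV[R]_2 :=
  if l == ord0 then \bigcup_(i in setT) A i else \bigcup_(j in setT) B j.
have [l|l z|z Cz] := Qsep C.
- by rewrite /C; case: (l == ord0); exists s; [exists A | exists B].
- move=> Qz; have [[j i] ez] := Q_arc _ _ Qz; rewrite /C.
  have [el|nl] := eqVneq l ord0.
    exists i => // j'; case: (eqVneq j j') => [<-|neq].
      have -> : first (j, i) by apply/asboolP; rewrite -ez -el.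
      by rewrite ez arc_tangent_same_arc subrr expr0n oppr0.
    have := @arc_tangent_other_arc j' j i neq.
    by rewrite ez; case: (first _) => // /ltW.
  have {nl}el : l = ord_max by apply: val_inj; case: l nl {Qz} => -[|[|//]].
  exists j => // i'; rewrite ez arc_tangent_same_arc.
  have [->|neq] := eqVneq i' i.
    have -> : first (j, i) = false.
      by apply/asboolP => h; apply: (Q_excl z); rewrite ?ez // -ez -el.
    by rewrite subrr expr0n oppr0.
  have neg : - ((i : nat)%:R - (i' : nat)%:R) ^+ 2 < 0 :> R.
    rewrite oppr_lt0 exprn_even_gt0 //= subr_eq0 eqr_nat.
    by apply: contra neq => /eqP e; apply/eqP/val_inj.
  by case: (first _) => //; apply: ltW.
have [i _ Az] : (\bigcup_(i in setT) A i) z by have := Cz ord0 I.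
have [j _ Bz] : (\bigcup_(j in setT) B j) z by have := Cz ord_max I.
have := Az j; have := Bz i; case: (first _); lra.
Qed.

End Lower.

(** * Existence and order of magnitude of the Tverberg number *)

Theorem theorem1p1 (R : realType) :
  exists c1 c2 : R, [/\ 0 < c1, 0 < c2 &
    forall s : nat, (0 < s)%N ->
      exists N : nat,
        is_s_tverberg_number R 2 (fun _ : 'I_2 => s) N /\
        c1 * s%:R ^+ 2 <= N%:R <= c2 * s%:R ^+ 2].
Proof.
exists 1, 672%:R; split=> [||s s0]; rewrite ?ltr01 ?ltr0n //.
pose bounded N := `[< s_tverberg_bound R 2 (fun _ : 'I_2 => s) N >].
have bounded672 : bounded (672 * s ^ 2)%N.
  exact/asboolP/s_tverberg_bound_quadratic.
have exN : exists N, bounded N by exists (672 * s ^ 2)%N.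
case: (ex_minnP exN) => N /asboolP bN minN; exists N; split.
  by split=> // M bM; apply: minN; apply/asboolP.
rewrite mul1r -natrX -natrM !ler_nat (minN _ bounded672) andbT.
exact: ltnW (s_tverberg_bound_gt s0 bN).
Qed.
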